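(* Algorithm SE-A runs in time $\mathcal{O}(nz)$ to create a graph of $n$ vertices using a selection of $z\ge 1$ edges in each round (with an absolute implied constant).
   Context: **Random systematic sampling (RSS).** Input: distinct elements $x_1,\dots,x_N$ with positive integer frequencies $d_1,\dots,d_N$, $s=\sum_i d_i$, and a sample size $m$ dividing $s$ (here always $d_i\le s/m$). Shuffle the elements uniformly at random, draw $r$ uniformly from $[0,s/m)$, set $psum=0$, and scan $i=1,\dots,N$: add $d_i$ to $psum$, and if $psum>r$, output $x_i$ and increase $r$ by $s/m$. **Algorithm SE-A** (parameter $z\ge1$, target order $n$, initial connected simple graph $\mathcal{G}_0$ with at least one edge). Start with $(V,E)=\mathcal{G}_0$. While $|V|<n$, perform a round: (1) select $z$ edges of $E$ independently and uniformly at random, with replacement; (2) form the bag of endpoints of these $z$ edges, each vertex with frequency equal to the number of selected edges (with multiplicity) containing it, and apply RSS with sample size $2$ to get a pair $\{u,w\}$; (3) add a new vertex $v$ to $V$ and the edges $\{v,u\},\{v,w\}$ to $E$. **Cost model.** Unit-cost RAM: drawing a uniform random number, accessing an edge by index, updating a counter indexed by a vertex, and appending a vertex or edge each take constant time; shuffling $N$ elements takes time $O(N)$. The running time is the worst-case total time of all rounds (the growth process). *)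

(* Defs.v *)
From mathcomp Require Import all_boot all_order all_algebra reals.

Set Implicit Arguments.
Unset Strict Implicit.
Unset Printing Implicit Defensive.

(* Vertices are 0, ..., nvertices - 1; each undirected edge is stored once, in an
   arbitrary orientation, in an array. *)
Record graph := Graph { nvertices : nat; edges : seq (nat * nat) }.

(* Loops are excluded too: a loop equals its own reversal. *)
Definition simple_graph (G : graph) : bool :=
  all (fun e => (e.1 < nvertices G) && (e.2 < nvertices G)) (edges G) &&
  uniq (edges G ++ [seq (e.2, e.1) | e <- edges G]).

Definition adjacent (G : graph) : rel 'I_(nvertices G) :=
  fun u v => ((nat_of_ord u, nat_of_ord v) \in edges G)
          || ((nat_of_ord v, nat_of_ord u) \in edges G).

Definition connected_graph (G : graph) : Prop :=
  0 < nvertices G /\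
  forall u v : 'I_(nvertices G), connect (adjacent (G := G)) u v.

(* Times, in machine steps, of the primitive operations of a unit-cost RAM.
   [t_elem] is the time of an arithmetic operation, a comparison, a branch, or
   an access to a local list. *)
Record cost_model := CostModel {
  t_elem : nat;
  t_random : nat;
  t_edge : nat;
  t_counter : nat;
  t_append : nat;
  t_shuffle : nat -> nat;
  t_shuffle_linear :
    exists c : nat, forall N : nat, 0 < N -> t_shuffle N <= c * N
}.

(* [drawn] is the number of random numbers consumed so far. *)
Record state := State {
  graph_of : graph;
  counter : nat -> nat;
  drawn : nat;
  clock : nat
}.

Definition initial_state (G : graph) : state := State G (fun=> 0) 0 0.

(* A sample point: the values of the successive random numbers, which are
   independent and uniform on [0, 1[. *)
Definition sample_point (R : realType) (omega : nat -> R) : Prop :=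
  forall i, (0 <= omega i < 1)%R.

Section Machine.
Context (R : realType) (cm : cost_model) (omega : nat -> R).

(* [None] is a fault, or lack of fuel in [while] below. *)
Definition comp (A : Type) : Type := state -> option (A * state).

Definition ret A (a : A) : comp A := fun st => Some (a, st).

Definition fault A : comp A := fun=> None.

Definition bind A B (p : comp A) (q : A -> comp B) : comp B :=
  fun st => if p st is Some (a, st') then q a st' else None.

Local Notation "'let*' x := p 'in' q" := (bind p (fun x => q))
  (at level 200, x name, p at level 200, q at level 200).

Definition charge (t : nat) : comp unit := fun st =>
  Some (tt, State (graph_of st) (counter st) (drawn st) (clock st + t)).

Definition elementary (k : nat) : comp unit := charge (k * t_elem cm).

Definition get A (f : state -> A) : comp A := fun st => Some (f st, st).

Definition next_random : comp R := fun st =>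
  Some (omega (drawn st),
        State (graph_of st) (counter st) (drawn st).+1 (clock st)).

Definition random : comp R :=
  let* _ := charge (t_random cm) in next_random.

Definition random_index (k : nat) : comp nat :=
  let* a := random in ret (Num.truncn (k%:R * a)%R).

(* For distinct elements, one uniform number selects a uniform element of the
   list of all [(size s)`!] orderings. *)
Definition shuffle (s : seq nat) : comp (seq nat) :=
  let* _ := charge (t_shuffle cm (size s)) in
  let* a := next_random in
  ret (nth s (permutations s) (Num.truncn ((size s)`!%:R * a)%R)).

Definition edge_count : comp nat :=
  let* _ := elementary 1 in get (fun st => size (edges (graph_of st))).

Definition read_edge (i : nat) : comp (nat * nat) :=
  let* _ := charge (t_edge cm) in
  let* E := get (fun st => edges (graph_of st)) in
  if i < size E then ret (nth (0, 0) E i) else fault _.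

Definition read_counter (v : nat) : comp nat :=
  let* _ := charge (t_counter cm) in get (fun st => counter st v).

Definition write_counter (v d : nat) : comp unit :=
  let* _ := charge (t_counter cm) in
  fun st => Some (tt, State (graph_of st)
                            (fun w => if w == v then d else counter st w)
                            (drawn st) (clock st)).

Definition append_vertex : comp nat :=
  let* _ := charge (t_append cm) in
  fun st => let G := graph_of st in
    Some (nvertices G, State (Graph (nvertices G).+1 (edges G))
                             (counter st) (drawn st) (clock st)).

Definition append_edge (u v : nat) : comp unit :=
  let* _ := charge (t_append cm) in
  fun st => let G := graph_of st in
    Some (tt, State (Graph (nvertices G) (rcons (edges G) (u, v)))
                    (counter st) (drawn st) (clock st)).

(* Every loop test costs one elementary operation. *)
Fixpoint foreach A B (s : seq A) (b : B) (body : B -> A -> comp B) : comp B :=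
  let* _ := elementary 1 in
  if s is x :: s' then let* b' := body b x in foreach s' b' body else ret b.

Fixpoint while (fuel : nat) (test : state -> bool) (body : comp unit)
    : comp unit :=
  if fuel is k.+1 then
    let* _ := elementary 1 in
    let* b := get test in
    if b then let* _ := body in while k test body else ret tt
  else fault _.

(* The scan of random systematic sampling; [acc] is (psum, r, output). *)
Definition rss_step (q : R) (acc : nat * R * seq nat) (x : nat)
    : comp (nat * R * seq nat) :=
  let: (psum, r, out) := acc in
  let* d := read_counter x in
  let* _ := elementary 2 in
  let psum' := psum + d in
  if (r < psum'%:R)%R
  then let* _ := elementary 2 in ret (psum', (r + q)%R, rcons out x)
  else ret (psum', r, out).

(* Random systematic sampling with sample size [m]: the distinct elements are
   listed in [xs] and their frequencies are held by the counters. *)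
Definition rss (m : nat) (xs : seq nat) : comp (seq nat) :=
  let* s := foreach xs 0 (fun s x =>
    let* d := read_counter x in let* _ := elementary 1 in ret (s + d)) in
  let* _ := elementary 1 in
  let q := (s%:R / m%:R)%R in
  let* ys := shuffle xs in
  let* a := random in
  let* _ := elementary 1 in
  let* acc := foreach ys (0, (q * a)%R, [::]) (rss_step q) in
  ret acc.2.

Definition select_edges (z : nat) : comp (seq (nat * nat)) :=
  foreach (iota 0 z) [::] (fun sel _ =>
    let* k := edge_count in
    let* i := random_index k in
    let* e := read_edge i in
    let* _ := elementary 1 in
    ret (rcons sel e)).

Definition add_to_bag (bag : seq nat) (v : nat) : comp (seq nat) :=
  let* d := read_counter v in
  let* _ := write_counter v d.+1 in
  let* _ := elementary 1 in
  if d == 0 then let* _ := elementary 1 in ret (rcons bag v) else ret bag.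

(* Counters are zero outside this computation; afterwards they hold the
   frequencies of the listed distinct vertices. *)
Definition make_bag (sel : seq (nat * nat)) : comp (seq nat) :=
  foreach sel [::] (fun bag e =>
    let* bag1 := add_to_bag bag e.1 in add_to_bag bag1 e.2).

Definition clear_counters (xs : seq nat) : comp unit :=
  foreach xs tt (fun _ x => write_counter x 0).

Definition round (z : nat) : comp unit :=
  let* sel := select_edges z in
  let* bag := make_bag sel in
  let* out := rss 2 bag in
  let* _ := clear_counters bag in
  if out is [:: u; w] then
    let* v := append_vertex in
    let* _ := append_edge v u in
    append_edge v w
  else fault _.

Definition SE_A (fuel z n : nat) : comp unit :=
  while fuel (fun st => nvertices (graph_of st) < n) (round z).

(* On the sample point [omega], the algorithm halts with graph [G] at time
   [t]. *)
Definition SE_A_halts (z n : nat) (G0 G : graph) (t : nat) : Prop :=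
  exists (fuel : nat) (st : state),
    [/\ SE_A fuel z n (initial_state G0) = Some (tt, st),
        graph_of st = G & clock st = t].

End Machine.

(* Main.v *)
Require Import Defs.
From mathcomp Require Import all_boot all_order all_algebra reals.
From mathcomp Require Import zify ring lra.

(** A round handles [z] edges and a bag of at most [2 z] distinct vertices, with
    a bounded number of operations on each, so it takes time [O(z)] and adds
    exactly one vertex; there are at most [n] rounds.

    The other point is that no round faults. Edges never are loops, so every
    vertex occurs at most [z] times among the [2 z] endpoints. Hence a vertex
    never covers two of the thresholds [r], [r + z], ... of the systematic
    sampling, and as [0 <= r < z] exactly two thresholds lie below [2 z]: the
    sample has size 2. *)

Import Order.TTheory GRing.Theory Num.Theory.

(** * Time-bounded Hoare triples *)

(** Total correctness within [k] steps; the existential excludes faults. Quantifying over [d] and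
    [c] makes a triple valid at any point of the random stream, so that triples compose. *)
Definition runs {A : Type} (p : Defs.comp A) (G : graph) (f : nat -> nat) (k : nat)
    (Q : A -> graph -> (nat -> nat) -> Prop) : Prop :=
  forall d c, exists a st', [/\ p (State G f d c) = Some (a, st'),
    clock st' <= c + k & Q a (graph_of st') (counter st')].

Lemma runs_weaken {A} {p : Defs.comp A} {G f k k'} {Q Q' : A -> _ -> _ -> Prop} :
  runs p G f k Q -> k <= k' -> (forall a G' f', Q a G' f' -> Q' a G' f') ->
  runs p G f k' Q'.
Proof.
move=> h kk' QQ' d c; have [a [st' [e ck q]]] := h d c.
by exists a, st'; split=> //; [lia | exact: QQ'].
Qed.

Lemma runs_leq {A} {p : Defs.comp A} {G f} k {k' Q} :
  runs p G f k Q -> k <= k' -> runs p G f k' Q.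
Proof. by move=> h kk'; apply: (runs_weaken h). Qed.

Lemma runs_ret {A} (a : A) G f (Q : A -> _ -> _ -> Prop) :
  Q a G f -> runs (ret a) G f 0 Q.
Proof. by move=> q d c; exists a, (State G f d c); split=> //=; lia. Qed.

Lemma runs_bind {A B} (p : Defs.comp A) (q : A -> Defs.comp B) G f k1 k2 Q :
  runs p G f k1 (fun a G' f' => runs (q a) G' f' k2 Q) ->
  runs (bind p q) G f (k1 + k2) Q.
Proof.
move=> h d c; have [a [[G1 f1 d1 c1] [/= e1 l1 h1]]] := h d c.
have [b [st2 [e2 l2 h2]]] := h1 d1 c1.
by exists b, st2; split=> //; [rewrite /bind e1 | lia].
Qed.

Lemma runs_charge {B} t (q : unit -> Defs.comp B) G f k Q :
  runs (q tt) G f k Q -> runs (bind (charge t) q) G f (t + k) Q.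
Proof.
by move=> h; apply: runs_bind => d c; do 2 eexists; split=> //=.
Qed.

(** The invariant [I] is indexed by the prefix already traversed. The last [t_elem] pays for the
    test that finds the list exhausted. *)
Lemma runs_foreach cm {A : eqType} {B} (s : seq A) (b : B) body G f k
    (I : seq A -> B -> graph -> (nat -> nat) -> Prop) :
  (forall p x b' G' f', x \in s -> I p b' G' f' ->
     runs (body b' x) G' f' k (I (rcons p x))) ->
  I [::] b G f ->
  runs (foreach cm s b body) G f (size s * (t_elem cm + k) + t_elem cm) (I s).
Proof.
suff gen p : (forall p x b' G' f', x \in s -> I p b' G' f' ->
     runs (body b' x) G' f' k (I (rcons p x))) -> I p b G f ->
  runs (foreach cm s b body) G f (size s * (t_elem cm + k) + t_elem cm) (I (p ++ s)).
  by move=> h hI; apply: (gen [::]).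
elim: s p b G f => [|x s IH] p b G f h hI.
  apply: (runs_leq (1 * t_elem cm + 0)); last by rewrite /=; lia.
  by apply: runs_charge; apply: runs_ret; rewrite cats0.
rewrite -cat_rcons.
apply: (runs_leq (1 * t_elem cm +
  (k + (size s * (t_elem cm + k) + t_elem cm)))); last by rewrite /=; lia.
apply: runs_charge; apply: runs_bind.
apply: (runs_weaken (h p x b G f (mem_head _ _) hI)) => // b' G' f' hI'.
by apply: IH hI' => p' y b1 G1 f1 ys; apply: h; rewrite inE ys orbT.
Qed.

(** * Edges and random draws *)

Section Round.
Context (R : realType) (cm : cost_model) (omega : nat -> R).
Hypothesis omegaP : sample_point omega.

(** A common unit that dominates every primitive except the shuffle. *)
Definition step_time : nat :=
  t_elem cm + t_random cm + t_edge cm + t_counter cm + t_append cm.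

Definition loopless (G : graph) : Prop :=
  forall e, e \in edges G ->
    [/\ e.1 < nvertices G, e.2 < nvertices G & e.1 != e.2].

Definition endpoints (sel : seq (nat * nat)) : seq nat :=
  flatten [seq [:: e.1; e.2] | e <- sel].

Lemma size_endpoints sel : size (endpoints sel) = 2 * size sel.
Proof. by elim: sel => //= e s IH; rewrite /endpoints /= in IH *; rewrite IH; lia. Qed.

Lemma endpoints_rcons sel e :
  endpoints (rcons sel e) = rcons (rcons (endpoints sel) e.1) e.2.
Proof. by rewrite /endpoints map_rcons flatten_rcons -!cats1 -catA. Qed.

(** Each loopless edge contributes at most one occurrence of [v]. This yields the sampling condition
    d_i <= s/m, with s/m = z. *)
Lemma count_endpoints sel v :
  all (fun e => e.1 != e.2) sel -> count_mem v (endpoints sel) <= size sel.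
Proof.
elim: sel => //= e s IH /andP[ne /IH {}IH]; rewrite /endpoints /= in IH *.
by case: (eqVneq e.1 v) ne => [->|_] /=; case: (eqVneq e.2 v) => //=; lia.
Qed.

Lemma runs_random G f :
  runs (random cm omega) G f (t_random cm)
    (fun a G' f' => [/\ G' = G, f' = f & (0 <= a < 1)%R]).
Proof. by move=> d c; do 2 eexists; split=> //; split=> //; exact: omegaP. Qed.

Lemma runs_shuffle s G f :
  runs (shuffle cm omega s) G f (t_shuffle cm (size s))
    (fun ys G' f' => [/\ G' = G, f' = f & perm_eq ys s]).
Proof.
move=> d c; do 2 eexists; split=> //; split=> //=.
set k := Num.truncn _.
(* Past the end, [nth] returns its default [s], which is also an ordering of [s]. *)
have [lt|le] := ltnP k (size (permutations s)); last by rewrite nth_default.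
by rewrite -mem_permutations mem_nth.
Qed.

(** The strict bound [omega d < 1] keeps the index in range, so [read_edge] does not fault. *)
Lemma random_index_lt k d :
  0 < k -> Num.truncn (k%:R * omega d)%R < k.
Proof.
move=> k0; have /andP[w0 w1] := omegaP d.
have k0R : (0 < k%:R :> R)%R by rewrite ltr0n.
by rewrite truncn_lt_nat ?mulr_ge0 ?ler0n// gtr_pMr.
Qed.

Lemma runs_select_edges z G f :
  0 < size (edges G) ->
  runs (select_edges cm omega z) G f (z * (5 * step_time) + step_time)
    (fun sel G' f' => [/\ G' = G, f' = f, size sel = z
                        & {subset sel <= edges G}]).
Proof.
move=> E0.
apply: (runs_weaken (@runs_foreach cm _ _ (iota 0 z) [::] _ G f (2 * t_elem cm + t_random cm + t_edge cm)
  (fun p sel G' f' => [/\ G' = G, f' = f, size sel = size p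
                        & {subset sel <= edges G}]) _ _)) => //.
- move=> p i sel _ _ _ [-> -> ss sub] d c.
  rewrite /bind /edge_count /elementary /charge /get /random_index /random /= /bind /=.
  rewrite /next_random /ret /= /read_edge /bind /charge /get /=.
  rewrite random_index_lt// /ret; do 2 eexists; split; first by [].
    by rewrite /=; lia.
  split=> //; first by rewrite !size_rcons ss.
  move=> e; rewrite mem_rcons inE => /predU1P[->|/sub//].
  by apply: mem_nth; apply: random_index_lt.
- by rewrite size_iota /step_time; nia.
- by move=> sel G' f'; rewrite size_iota.
Qed.

(** * Building and clearing the bag *)

Definition bagged (G : graph) (l bag : seq nat) (G' : graph) (f : nat -> nat) :
    Prop :=
  [/\ G' = G, forall v, f v = count_mem v l, uniq bag & bag =i l].

(** The counter of [v] is zero exactly when [v] has not been met, so testing it decides membership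
    in constant time and keeps the bag duplicate-free. *)
Lemma runs_add_to_bag G l bag v G' f :
  bagged G l bag G' f ->
  runs (add_to_bag cm bag v) G' f (4 * step_time) (bagged G (rcons l v)).
Proof.
move=> [-> fl ub bl] d c.
rewrite /add_to_bag /read_counter /write_counter /elementary /charge /get /bind /=.
have cnt w : (if w == v then (f v).+1 else f w) = count_mem w (rcons l v).
  by rewrite -cats1 count_cat /= addn0 fl eq_sym; case: eqVneq => [->|_]; rewrite ?fl ?addn1 ?addn0.
case: (posnP (f v)) => [fv0|fv0]; rewrite /ret.
  have vl : v \notin l by rewrite -has_pred1 has_count -fl fv0.
  do 2 eexists; split; first by rewrite fv0.
    by rewrite /= /step_time; lia.
  split; [by [] | by move=> w; rewrite -cnt fv0 | by rewrite rcons_uniq bl vl |].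
  by move=> w; rewrite !mem_rcons !inE bl.
have vl : v \in l by rewrite -has_pred1 has_count -fl.
do 2 eexists; split; first by [].
  by rewrite /= /step_time; lia.
split=> // w; rewrite mem_rcons inE bl.
by case: eqVneq => [->|].
Qed.

Lemma runs_make_bag sel G f :
  f =1 (fun=> 0) ->
  runs (make_bag cm sel) G f (size sel * (9 * step_time) + step_time)
    (bagged G (endpoints sel)).
Proof.
move=> f0.
apply: (runs_weaken (@runs_foreach cm _ _ sel [::] _ G f
  (4 * step_time + 4 * step_time)
  (fun p bag G' f' => bagged G (endpoints p) bag G' f') _ _)) => //.
- move=> p e bag G' f' _ h; apply: runs_bind.
  apply: (runs_weaken (runs_add_to_bag _ _ _ e.1 _ _ h)) => // b1 G1 f1 h1.
  rewrite endpoints_rcons; exact: runs_add_to_bag.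
- have te : t_elem cm <= step_time by rewrite /step_time; lia.
  by apply: leq_add => //; apply: leq_mul => //; lia.
Qed.

(** Only counters of the bag can be nonzero, so the reset takes time linear in the bag rather than
    in the graph. *)
Lemma runs_clear_counters bag G f :
  (forall v, v \notin bag -> f v = 0) ->
  runs (clear_counters cm bag) G f (size bag * (2 * step_time) + step_time)
    (fun _ G' f' => G' = G /\ f' =1 (fun=> 0)).
Proof.
move=> f0.
apply: (runs_weaken (@runs_foreach cm _ _ bag tt _ G f
  (t_counter cm)
  (fun p _ G' f' => G' = G /\ forall v, f' v = if v \in p then 0 else f v) _ _)) => //.
- move=> p x _ G' f' _ [-> h] d c; do 2 eexists; split=> //=.
  split=> // v; rewrite mem_rcons inE h.
  by case: eqVneq.
- by rewrite /step_time; nia.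
- move=> _ G' f' [-> h]; split=> // v; rewrite h.
  by case: ifPn => // /f0.
Qed.

(** * Systematic sampling *)

(** Up to order, [l] is made of constant blocks, one per distinct value. For the endpoints this
    gives s = 2z. *)
Lemma sum_count_mem (l bag : seq nat) :
  uniq bag -> bag =i l -> \sum_(x <- bag) count_mem x l = size l.
Proof.
move=> ub bl; have pb : perm_eq bag (undup l).
  by apply: uniq_perm; rewrite ?undup_uniq// => x; rewrite mem_undup bl.
rewrite (perm_big _ pb) -(perm_size (perm_count_undup l)) size_flatten sumnE.
by rewrite /shape -map_comp big_map; apply: eq_bigr => x _ /=; rewrite size_nseq.
Qed.

(** Here [r] is the next threshold. The two inequalities say that [out] has one entry for each
    threshold a + jz, j >= 0, lying strictly below [psum]. *)
Definition scanned (G : graph) (f : nat -> nat) (xs : seq nat) (a z : R)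
    (p : seq nat) (acc : nat * R * seq nat) (G' : graph) (f' : nat -> nat) :=
  let: (psum, r, out) := acc in
  [/\ G' = G, f' = f, psum = \sum_(x <- p) f x, {subset out <= xs} &
   [/\ r = (a + (size out)%:R * z)%R, (psum%:R <= r)%R
     & 0 < size out -> (r - z < psum%:R)%R]].

(** Since psum <= r and f x <= z, the new sum is at most r + z: an element passes at most one
    threshold, so a single comparison is enough. *)
Lemma runs_rss_step G f xs (a z : R) p acc x G' f' :
  x \in xs -> ((f x)%:R <= z)%R -> scanned G f xs a z p acc G' f' ->
  runs (rss_step cm z acc x) G' f' (t_counter cm + 4 * t_elem cm)
    (scanned G f xs a z (rcons p x)).
Proof.
case: acc => [[psum r] out] xxs fz [-> -> ps sub [er lr gr]] d c.
rewrite /rss_step /read_counter /elementary /charge /get /bind /=.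
have ps' : psum + f x = \sum_(x <- rcons p x) f x by rewrite big_rcons /= ps addnC.
case: ifP => [lt|/negbT]; last rewrite -leNgt => ge.
  do 2 eexists; split; first by []; first by rewrite /=; lia.
  rewrite natrD in lt *; split=> //.
    by move=> y; rewrite mem_rcons inE => /predU1P[->|/sub].
  rewrite size_rcons -natr1; split; first by rewrite er; ring.
    by rewrite natrD; lra.
  by move=> _; rewrite natrD; lra.
do 2 eexists; split; first by []; first by rewrite /=; lia.
split=> //; split=> // o0.
by apply: lt_le_trans (gr o0) _; rewrite ler_nat leq_addr.
Qed.

Lemma runs_rss bag G f z c :
  (forall N, 0 < N -> t_shuffle cm N <= c * N) ->
  0 < z -> 0 < size bag -> (forall x, x \in bag -> f x <= z) ->
  \sum_(x <- bag) f x = 2 * z ->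
  runs (rss cm omega 2 bag) G f
    (size bag * (9 * step_time + c) + 6 * step_time)
    (fun out G' f' => [/\ G' = G, f' = f, size out = 2
                        & {subset out <= bag}]).
Proof.
move=> hc z0 bag0 fz sf.
apply: (runs_leq ((size bag * (t_elem cm + (t_counter cm + t_elem cm)) + t_elem cm) +
  (1 * t_elem cm + (t_shuffle cm (size bag) + (t_random cm + (1 * t_elem cm +
   ((size bag * (t_elem cm + (t_counter cm + 4 * t_elem cm)) + t_elem cm) + 0))))))); last first.
  by have := hc _ bag0; rewrite /step_time; nia.
apply: runs_bind.
apply: (runs_weaken (@runs_foreach cm _ _ bag 0 _ G f
  (t_counter cm + t_elem cm)
  (fun p s G' f' => [/\ G' = G, f' = f & s = \sum_(x <- p) f x]) _ _)) => //.
- move=> p x s _ _ _ [-> -> ->] d t; do 2 eexists; split; [by [] | by rewrite /=; lia |].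
  by split=> //; rewrite big_rcons /= addnC.
- by split=> //; rewrite big_nil.
move=> s _ _ [-> -> ->]; rewrite sf; apply: runs_charge.
have -> : ((2 * z)%:R / 2%:R = z%:R :> R)%R by rewrite natrM mulrAC divff ?mul1r// pnatr_eq0.
apply: runs_bind; apply: (runs_weaken (runs_shuffle bag G f)) => // ys _ _ [-> -> pys].
apply: runs_bind; apply: (runs_weaken (runs_random G f)) => // w _ _ [-> -> /andP[w0 w1]].
have zR : (0 < z%:R :> R)%R by rewrite ltr0n.
apply: runs_charge; apply: runs_bind; rewrite -(perm_size pys).
apply: (runs_weaken (@runs_foreach cm _ _ ys _ _ G f
  (t_counter cm + 4 * t_elem cm)
  (scanned G f bag (z%:R * w)%R z%:R) _ _)) => //.
- move=> p x acc G' f' xys; apply: runs_rss_step.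
    by rewrite -(perm_mem pys).
  by rewrite ler_nat fz// -(perm_mem pys).
- split=> //; first by rewrite big_nil.
  by split=> //=; rewrite ?mul0r ?addr0// mulr_ge0// ltW.
move=> [[psum r] out] G' f' [-> -> ps sub [er lr gr]]; apply: runs_ret; split=> //=.
move: ps; rewrite (perm_big _ pys) sf => ps; rewrite {}ps natrM in lr gr.
have aw : (z%:R * w < z%:R)%R by rewrite gtr_pMr.
have aw0 : (0 <= z%:R * w)%R by rewrite mulr_ge0// ltW.
(* With k outputs and a = zw in [0, z), the final sum 2z satisfies 2z <= a + kz < (k + 1)z, so k >
   1; then a + (k - 1)z < 2z gives k < 3. *)
have o2 : 1 < size out.
  rewrite -(ltr_nat R) -(ltr_pM2r zR); lra.
have := gr (ltnW o2); rewrite er => lt.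
have o3 : size out < 3.
  rewrite -(ltr_nat R) -(ltr_pM2r zR); lra.
by lia.
Qed.

(** * One round and the growth loop *)

(** The invariant between rounds: zero counters start the next bag, looplessness bounds its
    frequencies, and a nonempty edge array allows the draws. *)
Definition growing (G : graph) (f : nat -> nat) : Prop :=
  [/\ f =1 (fun=> 0), loopless G & 0 < size (edges G)].

Lemma runs_round z c G f :
  (forall N, 0 < N -> t_shuffle cm N <= c * N) ->
  0 < z -> growing G f ->
  runs (round cm omega z) G f (z * (60 * step_time + 2 * c))
    (fun _ G' f' => growing G' f' /\ nvertices G' = (nvertices G).+1).
Proof.
move=> hc z0 [f0 nl E0].
(* Selection, bag, sampling, clearing and three appends total (36z + 12) [step_time] + 2zc; [0 < z]
   absorbs the constant term. *)
apply: (runs_leq ((z * (5 * step_time) + step_time) +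
  ((z * (9 * step_time) + step_time) + (((2 * z) * (9 * step_time + c) + 6 * step_time)
   + (((2 * z) * (2 * step_time) + step_time) + 3 * step_time))))); last by nia.
apply: runs_bind.
apply: (runs_weaken (runs_select_edges z G f E0)) => // sel _ _ [-> -> ssel sub].
apply: runs_bind.
have hb := runs_make_bag sel G f f0; rewrite ssel in hb.
apply: (runs_weaken hb) => // {hb} bag _ f1 [-> fl ub bl].
have sb : \sum_(x <- bag) f1 x = 2 * z.
  rewrite (eq_bigr (fun x => count_mem x (endpoints sel))) => [|x _]; last exact: fl.
  by rewrite sum_count_mem// size_endpoints ssel.
have bag0 : 0 < size bag by case: (bag) sb => //; rewrite big_nil; lia.
have bag2 : size bag <= 2 * z.
  by rewrite -ssel -size_endpoints; apply: uniq_leq_size => // x; rewrite bl.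
have nls : all (fun e => e.1 != e.2) sel.
  by apply/allP => e /sub /nl[].
apply: runs_bind.
apply: (runs_weaken (@runs_rss bag G f1 z c hc z0 bag0 _ sb)).
- by move=> x _; rewrite fl -ssel; apply: count_endpoints.
- by rewrite leq_add2r leq_mul2r bag2 orbT.
move=> out _ _ [-> -> sout subo].
apply: runs_bind; apply: (runs_weaken (@runs_clear_counters bag G f1 _)).
- by move=> v; rewrite bl => nv; rewrite fl; apply/count_memPn.
- by rewrite leq_add2r leq_mul2r bag2 orbT.
move=> _ _ f2 [-> f20].
case: out sout subo => [|u [|w []]]//= _ subo.
have ltV x : x \in [:: u; w] -> x < nvertices G.
  move=> /subo; rewrite bl => /flatten_mapP[e /sub /nl[e1 e2 _]].
  by rewrite !inE => /orP[]/eqP->.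
have := ltV u; have := ltV w; rewrite !inE !eqxx ?orbT => /(_ isT) ltw /(_ isT) ltu.
move=> d t; rewrite /append_vertex /append_edge /bind /charge /=.
do 2 eexists; split; first by [].
  by rewrite /= /step_time; lia.
split=> //; split=> //=; last by rewrite !size_rcons.
(* The new vertex is numbered [nvertices G], above both sampled vertices, so neither new edge is a
   loop. *)
move=> e /=; rewrite !(mem_rcons, inE) => /or3P[/eqP->|/eqP->|/nl[e1 e2 ne]] /=.
- by split=> //; [lia | rewrite gtn_eqF].
- by split=> //; [lia | rewrite gtn_eqF].
- by split=> //; exact: ltnW.
Qed.

(** Each round adds one vertex, so [m] bounds the remaining rounds; the extra unit of fuel serves
    the final failing test. *)
Lemma runs_while z c n m G f :
  (forall N, 0 < N -> t_shuffle cm N <= c * N) ->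
  0 < z -> growing G f -> n - nvertices G <= m ->
  runs (while cm m.+1 (fun st => nvertices (graph_of st) < n)
          (round cm omega z)) G f
    (m * (t_elem cm + z * (60 * step_time + 2 * c)) + t_elem cm)
    (fun _ G' _ => nvertices G' = maxn n (nvertices G)).
Proof.
move=> hc z0; elim: m G f => [|m IH] G f gr nm.
  have/negbTE ge : ~~ (nvertices G < n) by lia.
  move=> d t; rewrite /= /elementary /bind /charge /get /= ge.
  by do 2 eexists; split=> //=; lia.
have [lt|le] := ltnP (nvertices G) n; last first.
  have/negbTE ge : ~~ (nvertices G < n) by lia.
  move=> d t; rewrite /= /elementary /bind /charge /get /= ge.
  by do 2 eexists; split=> //=; lia.
apply: (runs_leq (1 * t_elem cm + (0 + (z * (60 * step_time + 2 * c) +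
  (m * (t_elem cm + z * (60 * step_time + 2 * c)) + t_elem cm))))); last by lia.
apply: runs_charge; apply: runs_bind => d t; do 2 eexists; split=> //=; first by rewrite /=; lia.
rewrite lt; apply: runs_bind.
apply: (runs_weaken (runs_round z c G f hc z0 gr)) => // _ G1 f1 [gr1 n1].
have nm1 : n - nvertices G1 <= m by lia.
by apply: (runs_weaken (IH G1 f1 gr1 nm1)) => // _ G2 _ ->; lia.
Qed.

End Round.

(** * The initial graph and the absolute constant *)

Lemma simple_graph_loopless (G : graph) : simple_graph G -> loopless G.
Proof.
move=> /andP[/allP bnd]; rewrite cat_uniq => /and3P[_ /hasPn nl _] e eE.
have /andP[e1 e2] := bnd e eE; split=> //; apply/negP => /eqP ee.
have /nl/negP[] : (e.2, e.1) \in [seq (e.2, e.1) | e <- edges G].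
  exact: (map_f (fun e => (e.2, e.1)) eE).
by move: eE; rewrite {1}(surjective_pairing e) ee.
Qed.

Theorem theorem6 (cm : cost_model) :
  exists C : nat, forall (R : realType) (z n : nat) (G0 : graph),
    0 < z -> 0 < n ->
    simple_graph G0 -> connected_graph G0 -> 0 < size (edges G0) ->
    forall omega : nat -> R, sample_point omega ->
      exists (G : graph) (t : nat),
        [/\ SE_A_halts cm omega z n G0 G t,
            nvertices G = maxn n (nvertices G0)
          & t <= C * (n * z)].
Proof.
have [c hc] := t_shuffle_linear cm.
(* One [t_elem] pays for the test before each round, the other for the final test, as nz >= 1. Only
   [cm] enters the constant. *)
exists (2 * t_elem cm + (60 * step_time cm + 2 * c)).
move=> R z n G0 z0 n0 simple _ E0 omega omegaP.
have gr : growing G0 (fun=> 0) by split=> //; exact: simple_graph_loopless.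
have [[] [st [e l hn]]] := @runs_while R cm omega omegaP z c n n G0 _ hc z0 gr (leq_subr _ _) 0 0.
exists (graph_of st), (clock st); split=> //; first by exists n.+1, st.
by nia.
Qed.
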